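(* Let $G(p)\in\mathbb{C}[p]$ be a polynomial of degree at most $4$ with distinct roots, in the sense that it has four distinct roots on $\mathbb{C}P^1$, where $\infty$ is counted as a root of multiplicity $4-\deg G$. Then there is no Poisson structure on the set of variables $z_1(x),z_2(x)$ of the form $$\{z_a(x),z_b(y)\}=\sum_{1\le c,d\le 2}q_{ab}^{cd}\,z_c(x)z_d(x)\,\delta'(x-y)+\sum_{1\le c,d\le 2}r_{ab}^{cd}\,z_c(x)z_d'(x)\,\delta(x-y),\qquad a,b\in\{1,2\},$$ with constants $q_{ab}^{cd},r_{ab}^{cd}\in\mathbb{C}$, such that $p(x)=\frac{z_1(x)}{z_2(x)}$ satisfies, by virtue of these brackets, $$\{p(x),p(y)\}=G(p(x))\,\delta'(x-y)+\tfrac12 G'(p(x))\,p'(x)\,\delta(x-y).$$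
   Context: Here $x,y$ are loop (space) variables, $\delta$ is the delta function, $\delta'$ its derivative; $z_a'(x)$, $p'(x)$ denote $x$-derivatives and $G'$ is the derivative of the polynomial $G$. Brackets of fields are extended to functions of the fields and their derivatives in the usual way for Poisson structures of hydrodynamic type: by bilinearity, the Leibniz rule, and compatibility with differentiation in $x$ and $y$; $\{A(x),B(y)\}$ is understood as a distribution in $x,y$ supported on $x=y$. ''Poisson structure'' means that anticommutativity $\{A(x),B(y)\}=-\{B(y),A(x)\}$ and the Jacobi identity hold. *)

(* Defs.v *)
From HB Require Import structures.
From mathcomp Require Import all_boot all_order all_algebra.
From mathcomp Require Import reals complex.
From mathcomp Require Import mpoly.

Set Implicit Arguments.
Unset Strict Implicit.
Unset Printing Implicit Defensive.

Import GRing.Theory.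
Local Open Scope ring_scope.

(* CP^1 is [option C], with [None] the point at infinity. *)
Definition P1_mult (C : fieldType) (G : {poly C}) (t : option C) : nat :=
  if t is Some a then mup a G else (4 - (size G).-1)%N.

Definition four_distinct_P1_roots (C : fieldType) (G : {poly C}) : Prop :=
  G != 0 /\
  exists s : seq (option C),
    [/\ uniq s, size s = 4%N & all (fun t => 0 < P1_mult G t)%N s].

(* A is the field of differential rational functions in the fields z_1, z_2:
   it carries a derivation d (the derivative in the loop variable) vanishing on
   the constants C, the jets iter n d (z a) are algebraically independent over
   C, and every element is a quotient of polynomials in them. *)
Section Jets.
Variables (C A : fieldType) (iota : {rmorphism C -> A}).
Variables (d : A -> A) (z : 'I_2 -> A).

Definition jet_eval (N : nat) (v : 'I_N -> 'I_2 * nat) (P : {mpoly C[N]}) : A :=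
  mmap iota (fun i => iter (v i).2 d (z (v i).1)) P.

Record is_jet_field : Prop := IsJetField {
  jet_derD : forall f g, d (f + g) = d f + d g;
  jet_derM : forall f g, d (f * g) = d f * g + f * d g;
  jet_derC : forall c, d (iota c) = 0;
  jet_free : forall (N : nat) (v : 'I_N -> 'I_2 * nat), injective v ->
    forall P : {mpoly C[N]}, jet_eval v P = 0 -> P = 0;
  jet_gen : forall f : A, exists (N : nat) (v : 'I_N -> 'I_2 * nat)
    (P Q : {mpoly C[N]}), jet_eval v Q != 0 /\ f = jet_eval v P / jet_eval v Q
}.

End Jets.

(* The polynomial D stands for the distribution
     \sum_k D`_k(x) delta^(k)(x - y)
   supported on the diagonal x = y. *)
Section TwoPoints.
Variables (A : fieldType) (d : A -> A).

Definition dist2 := {poly A}.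
Implicit Types (D : dist2) (f : A).

Definition dist2_dx D : dist2 := map_poly d D + 'X * D.
Definition dist2_dy D : dist2 := - ('X * D).

Definition dist2_xmul f D : dist2 := f%:P * D.

(* f(y) delta^(k)(x - y) = (d/dx)^k (f(y) delta(x - y))
                         = (d/dx)^k (f(x) delta(x - y)) *)
Definition dist2_ymul f D : dist2 :=
  \sum_(k < size D) dist2_xmul D`_k (iter k dist2_dx f%:P).

(* Exchange of x and y:
   E(y) delta^(k)(y - x) = (- d/dx)^k (E(x) delta(x - y)) *)
Definition dist2_swap D : dist2 :=
  \sum_(k < size D) iter k (fun T => - dist2_dx T) (D`_k)%:P.

End TwoPoints.

(* T : {poly {poly A}} stands for the distribution
     \sum_(j, k) T`_k`_j(x) delta^(j)(x - y) delta^(k)(x - w)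
   supported on the diagonal x = y = w. *)
Section ThreePoints.
Variables (A : fieldType) (d : A -> A).

Definition dist3 := {poly {poly A}}.
Implicit Type T : dist3.

Definition dist3_dx T : dist3 :=
  map_poly (map_poly d) T + 'X%:P * T + 'X * T.
Definition dist3_dy T : dist3 := - ('X%:P * T).
Definition dist3_dw T : dist3 := - ('X * T).

(* For (s, t, r) a permutation of (x, y, w), with dt and dr the derivatives in
   t and r, this is the distribution {a(s), {b(t), c(r)}}.  If
     {b(t), c(r)} = \sum_k D_k(t) delta^(k)(t - r)  and
     {a(s), D_k(t)} = \sum_m E_km(s) delta^(m)(s - t),
   it is the sum over k, m of
     E_km(s) delta^(m)(s - t) delta^(k)(t - r)
       = (- dr)^k (- (dt + dr))^m (E_km(s) delta(s - t) delta(t - r)),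
   where E_km(s) may be replaced by E_km(x) in front of the delta functions. *)
Definition nested_bracket (br : A -> A -> dist2 A) (dt dr : dist3 -> dist3)
    (a b c : A) : dist3 :=
  \sum_(k < size (br b c)) \sum_(m < size (br a (br b c)`_k))
    iter k (fun T => - dr T)
      (iter m (fun T => - (dt T + dr T)) ((br a (br b c)`_k)`_m)%:P%:P).

End ThreePoints.

Section Brackets.
Variables (C A : fieldType) (iota : {rmorphism C -> A}) (d : A -> A).

(* br a b is the distribution {a(x), b(y)}. *)
Record is_local_bracket (br : A -> A -> dist2 A) : Prop := IsLocalBracket {
  brDl : forall a a' b, br (a + a') b = br a b + br a' b;
  brDr : forall a b b', br a (b + b') = br a b + br a b';
  brZl : forall c a b, br (iota c * a) b = dist2_xmul (iota c) (br a b);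
  brZr : forall c a b, br a (iota c * b) = dist2_xmul (iota c) (br a b);
  brMl : forall a a' b,
    br (a * a') b = dist2_xmul a (br a' b) + dist2_xmul a' (br a b);
  brMr : forall a b b',
    br a (b * b') = dist2_ymul d b (br a b') + dist2_ymul d b' (br a b);
  brdl : forall a b, br (d a) b = dist2_dx d (br a b);
  brdr : forall a b, br a (d b) = dist2_dy (br a b)
}.

Record is_Poisson_structure (br : A -> A -> dist2 A) : Prop :=
  IsPoissonStructure {
  Poisson_local : is_local_bracket br;
  Poisson_anticomm : forall a b, br a b = - dist2_swap d (br b a);
  (* {a(x),{b(y),c(w)}} + {b(y),{c(w),a(x)}} + {c(w),{a(x),b(y)}} = 0 *)
  Poisson_Jacobi : forall a b c,
    nested_bracket br (@dist3_dy A) (@dist3_dw A) a b c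
    + nested_bracket br (@dist3_dw A) (dist3_dx d) b c a
    + nested_bracket br (dist3_dx d) (@dist3_dy A) c a b = 0
}.

(* The distribution f(x) delta'(x - y) + g(x) delta(x - y). *)
Definition hydro_dist (f g : A) : dist2 A := f%:P * 'X + g%:P.

End Brackets.

(* Main.v *)
Require Import Defs.
From mathcomp Require Import all_boot all_order all_algebra.
From mathcomp Require Import reals complex.
From mathcomp Require Import mpoly.
From mathcomp Require Import zify ring.

Set Implicit Arguments.
Unset Strict Implicit.
Unset Printing Implicit Defensive.

Import GRing.Theory.
Local Open Scope ring_scope.

(** Write p = z_1/z_2, w = z_2 and, formally, u = log w.  As the bracket is
homogeneous in z_1, z_2, its coefficients in the coordinates p, u depend on p
alone: with polynomials B, K, b1, E,

  {p(x), p(y)} = G delta' + G' p'/2 delta,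
  {p(x), u(y)} = B delta' + (b1 p' + (E - B) u') delta,
  {u(x), u(y)} = K delta' + K' p'/2 delta.

In geometric terms G, B, K are the entries of a flat contravariant metric for
which d/du is a Killing field.  The squared length of this field has the form
(t + c)^2 up to a factor, or is constant, where t is the integral of
dp / sqrt G.  For G with four distinct roots t is an elliptic integral, so only
the constant is compatible with rational coefficients, and a metric of this
kind does not come from a bracket quadratic in the z_a.

The algebraic form of this argument works for degenerate metrics as well.  Put
beta = E - B.  The Jacobi identity yields

  G (B' - b1) = (G'/2 + beta) B,       2 (b1 B + beta K) = G K',
  G beta' = G'/2 beta + beta^2

([Jacobi_pwp_coef2], [Jacobi_pww_coef2], and [Jacobi_pwp_coef0] combined with
the first).  The last equation is a Riccati equation whose nonzero solutions
are - sqrt G / (t + c); that none of them is a polynomial follows from the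
multiplicity of a root of beta ([riccati_poly_eq0]).  Hence beta = 0, and the
first equation shows that B vanishes at every root of G.  By degrees B = k G
with k constant, then K' = k^2 G', so k = 0, B = 0 and K is constant.  But the
bracket of z_1 with itself forces G + 2 p B + p^2 K to be of degree at most 2,
whereas G has degree at least 3 ([constant_norm_absurd]).

Two devices give access to these equations.  Integrating the Jacobi identity
over its third point turns it into the statement that the flow of the integral
of any element is a derivation of the bracket ([flow_bracket]); this involves
only distributions in two points.  The algebraic independence of the jets
allows an identity between differential rational functions to be evaluated at
a jet with prescribed constant or polynomial entries ([specializes_inj]).  At
the jet used here p is the variable of the polynomials, w = w'' = 1 and
p' = p'' = w' = 0. *)

(** Turns a consequence of a known equation into a ring identity. *)
Lemma eq_mod_eq (V : zmodType) (x y a b : V) : a = b -> x - y = a - b -> x = y.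
Proof. by move=> -> /eqP; rewrite subrr subr_eq0 => /eqP. Qed.


(** * Coefficients of two-point distributions *)

Section Derivation.
Variables (A : fieldType) (d : A -> A).
Hypothesis dD : forall f g, d (f + g) = d f + d g.

Lemma der0 : d 0 = 0.
Proof. by apply: (addrI (d 0)); rewrite -dD !addr0. Qed.

Lemma derN f : d (- f) = - d f.
Proof. by apply: (addrI (d f)); rewrite -dD !subrr der0. Qed.

Lemma coef_dx (D : dist2 A) n :
  (dist2_dx d D)`_n = d D`_n + (if n is m.+1 then D`_m else 0).
Proof.
rewrite /dist2_dx coefD coefXM coef_map_id0 ?der0 //.
by case: n.
Qed.

Lemma coef_dy (D : dist2 A) n :
  (dist2_dy D)`_n = - (if n is m.+1 then D`_m else 0).
Proof. by rewrite /dist2_dy coefN coefXM; case: n. Qed.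

Lemma dist2_dxD (D E : dist2 A) :
  dist2_dx d (D + E) = dist2_dx d D + dist2_dx d E.
Proof.
apply/polyP=> n; rewrite coefD !coef_dx coefD dD.
by case: n => [|n]; rewrite ?coefD; ring.
Qed.

(** The orders that occur are at most 2: hydrodynamic brackets have order 1 and
one derivative of an argument adds 1. *)
Lemma coef_ymul (f : A) (D : dist2 A) : (size D <= 3)%N ->
  [/\ (dist2_ymul d f D)`_2 = f * D`_2,
      (dist2_ymul d f D)`_1 = f * D`_1 + 2 * d f * D`_2
    & (dist2_ymul d f D)`_0 = f * D`_0 + d f * D`_1 + d (d f) * D`_2].
Proof.
move=> sD; have -> : dist2_ymul d f D =
    \sum_(k < 3) dist2_xmul D`_k (iter k (dist2_dx d) f%:P).
  rewrite /dist2_ymul (big_ord_widen _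
    (fun k => dist2_xmul D`_k (iter k (dist2_dx d) f%:P)) sD).
  rewrite big_mkcond /=; apply: eq_bigr => k _; case: ltnP => // sk.
  by rewrite nth_default // /dist2_xmul mul0r.
rewrite !big_ord_recr big_ord0 /= add0r /dist2_xmul.
have Cf n : f%:P`_n = if n is 0 then f else 0 by rewrite coefC; case: n.
by split; rewrite !coefD !coefCM ?(coef_dx, Cf) /= ?(coef_dx, Cf) /=
  ?(der0, dD, Cf); ring.
Qed.

Lemma swap_coef0 (D : dist2 A) :
  (dist2_swap d D)`_0 = \sum_(k < size D) iter k (fun f => - d f) D`_k.
Proof.
rewrite coef_sum; apply: eq_bigr => k _.
elim: (nat_of_ord k) (D`_k) => [|m IH] f; first by rewrite coefC.
by rewrite 2!iterS coefN coef_dx addr0 IH.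
Qed.

Lemma size_ymul (f : A) (D : dist2 A) : (size (dist2_ymul d f D) <= size D)%N.
Proof.
apply: (leq_trans (size_sum _ _ _)); apply/bigmax_leqP => k _.
rewrite /dist2_xmul (leq_trans (size_polyMleq _ _)) //.
have sk : (size (iter k (dist2_dx d) f%:P) <= k.+1)%N.
  elim: (nat_of_ord k) => [|n IH]; first exact: size_polyC_leq1.
  apply/leq_sizeP=> -[|j] // nj; rewrite iterS coef_dx //.
  rewrite !nth_default ?der0 ?addr0 //; first exact: leq_trans IH _.
  exact: leq_trans IH (ltnW _).
have := size_polyC_leq1 D`_k; have := ltn_ord k; lia.
Qed.

Lemma coef_swap2 (D : dist2 A) : (size D <= 2)%N ->
  (dist2_swap d D)`_0 = D`_0 - d D`_1 /\ (dist2_swap d D)`_1 = - D`_1.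
Proof.
move=> sD; have -> : dist2_swap d D =
    \sum_(k < 2) iter k (fun T => - dist2_dx d T) (D`_k)%:P.
  rewrite /dist2_swap (big_ord_widen _
    (fun k => iter k (fun T => - dist2_dx d T) (D`_k)%:P) sD).
  rewrite big_mkcond /=; apply: eq_bigr => k _; case: ltnP => // sk.
  rewrite nth_default //; elim: (nat_of_ord k) => //= n <-.
  by apply/polyP=> -[|i]; rewrite coefN coef_dx !coef0 der0 ?coef0 addr0 oppr0.
rewrite !big_ord_recr big_ord0 /= add0r.
have Cf (f : A) n : f%:P`_n = if n is 0 then f else 0 by rewrite coefC; case: n.
by rewrite !coefD !coefN !coef_dx // !Cf der0; split; ring.
Qed.

End Derivation.

(** * The flow of an integral is a derivation of the bracket *)

Lemma sum_recl_zero (V : nmodType) (F : nat -> V) n :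
  (forall k, (0 < k)%N -> F k = 0) -> (n = 0%N -> F 0%N = 0) ->
  \sum_(k < n) F k = F 0%N.
Proof.
case: n => [|n] F0 Fn; first by rewrite big_ord0 Fn.
by rewrite big_ord_recl big1 ?addr0 // => i _; apply: F0.
Qed.

Lemma coef0_iter (A : nzRingType) (F : {poly {poly A}} -> {poly {poly A}})
    (H : {poly A} -> {poly A}) k T :
  (forall T, (F T)`_0 = H T`_0) -> (iter k F T)`_0 = iter k H T`_0.
Proof. by move=> FH; elim: k => //= k <-. Qed.

Section Poisson.
Variables (C A : fieldType) (iota : {rmorphism C -> A}) (d : A -> A).
Variable br : A -> A -> dist2 A.
Hypothesis dD : forall f g, d (f + g) = d f + d g.
Hypothesis hP : is_Poisson_structure iota d br.

Let hL := Poisson_local hP.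
Let d0 : d 0 = 0 := der0 dD.

Lemma br0l b : br 0 b = 0.
Proof. by apply: (addrI (br 0 b)); rewrite -(brDl hL) !addr0. Qed.

Lemma br0r a : br a 0 = 0.
Proof. by apply: (addrI (br a 0)); rewrite -(brDr hL) !addr0. Qed.

Lemma brNl a b : br (- a) b = - br a b.
Proof. by apply: (addrI (br a b)); rewrite -(brDl hL) !subrr br0l. Qed.

Lemma br_suml n (F : nat -> A) b :
  br (\sum_(i < n) F i) b = \sum_(i < n) br (F i) b.
Proof.
exact: (big_morph (fun a => br a b) (fun x y => brDl hL x y b) (br0l b)).
Qed.

(** The bracket {a(x), I} with the functional I given by the integral of c:
the derivatives of delta integrate to 0. *)
Definition flow (c a : A) : A := (br a c)`_0.

(** A distribution in three points is integrated over its third point by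
taking the coefficient of degree 0 in the outer variable, because
delta^(k)(x - w) has integral 0 for k > 0 and 1 for k = 0.  Here the integral
falls on the inner bracket. *)
Lemma int_nested_bracket_abc a b c :
  (nested_bracket br (@dist3_dy A) (@dist3_dw A) a b c)`_0 = br a (flow c b).
Proof.
rewrite /nested_bracket coef_sum.
under eq_bigr => k _ do rewrite coef_sum.
pose H t : {poly A} := 'X * t.
have term k m (E : A) :
    (iter k (fun T => - dist3_dw T)
      (iter m (fun T => - (dist3_dy T + dist3_dw T)) E%:P%:P))`_0
    = if k is 0 then 'X^m * E%:P else 0.
  rewrite (@coef0_iter _ _ (fun=> 0)); last first.
    by move=> T; rewrite /dist3_dw opprK coefXM.
  case: k => //=.
  rewrite (@coef0_iter _ _ H); last first.
    move=> T; rewrite /dist3_dy /dist3_dw -opprD opprK coefD coefXM /= addr0.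
    by rewrite coefCM.
  by rewrite coefC /= /H; elim: m => [|m IH]; rewrite ?mul1r //= IH exprS mulrA.
under eq_bigr => k _ do under eq_bigr => m _ do rewrite term.
rewrite (@sum_recl_zero _ (fun k => \sum_(m < size (br a (br b c)`_k))
    match k with 0 => 'X^m * ((br a (br b c)`_k)`_m)%:P | k'.+1 => 0 end)).
- rewrite /flow; set D := br a _.
  rewrite -[RHS]coefK poly_def; apply: eq_bigr => m _.
  by rewrite mulrC mul_polyC.
- by case=> // k _; rewrite big1.
- move/eqP; rewrite size_poly_eq0 => /eqP->.
  by rewrite coef0 br0r size_poly0 big_ord0.
Qed.

(** The inner sum of derivatives is the swap of a bracket with b, hence by
anticommutativity a bracket in the other order; the outer one assembles the
constant coefficient of the swap of {c, a}, which is the flow of a. *)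
Lemma int_nested_bracket_bca a b c :
  (nested_bracket br (@dist3_dw A) (dist3_dx d) b c a)`_0 = br (flow c a) b.
Proof.
rewrite /nested_bracket coef_sum.
have dx0 T : (dist3_dx d T)`_0 = dist2_dx d T`_0.
  rewrite /dist3_dx !coefD coefXM /= addr0 coefCM /dist2_dx.
  by rewrite coef_map_id0 // /map_poly poly_def size_poly0 big_ord0.
have it_sum k n (F : nat -> dist2 A) :
    iter k (fun T => - dist2_dx d T) (\sum_(i < n) F i)
    = \sum_(i < n) iter k (fun T => - dist2_dx d T) (F i).
  elim: k => //= k ->.
  apply: (big_morph (fun T => - dist2_dx d T)).
    by move=> x y; rewrite dist2_dxD // opprD.
  apply/polyP=> i; rewrite coefN coef_dx // !coef0 d0.
  by case: i => [|i]; rewrite ?coef0 addr0 oppr0.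
have inner k : (\sum_(m < size (br b (br c a)`_k))
    iter k (fun T => - dist3_dx d T) (iter m
      (fun T => - (dist3_dw T + dist3_dx d T)) ((br b (br c a)`_k)`_m)%:P%:P))`_0
   = - br (iter k (fun f => - d f) (br c a)`_k) b.
  set D := br b _; rewrite coef_sum.
  transitivity (iter k (fun T => - dist2_dx d T) (dist2_swap d D)).
    rewrite /dist2_swap.
    rewrite (it_sum _ _ (fun i => iter i (fun T => - dist2_dx d T) (D`_i)%:P)).
    apply: eq_bigr => m _.
    rewrite (@coef0_iter _ _ (fun T => - dist2_dx d T)); last first.
      by move=> T; rewrite coefN dx0.
    rewrite (@coef0_iter _ _ (fun T => - dist2_dx d T)) ?coefC //.
    by move=> T; rewrite coefN coefD dx0 coefN coefXM /= oppr0 add0r.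
  have -> : dist2_swap d D = - br (br c a)`_k b.
    by rewrite [X in - X](Poisson_anticomm hP) opprK.
  elim: (k) ((br c a)`_k) => //= j IH f; rewrite IH.
  by rewrite -[X in dist2_dx d X]brNl -(brdl hL) derN.
under eq_bigr => k _ do rewrite inner.
rewrite sumrN.
rewrite -(br_suml _ (fun k => iter k (fun f => - d f) (br c a)`_k)).
by rewrite -swap_coef0 // -brNl -coefN -(Poisson_anticomm hP).
Qed.

(** The coefficients of {a, b} are the only factors bracketed with c, so each
of them is replaced by its flow. *)
Lemma int_nested_bracket_cab a b c :
  (nested_bracket br (dist3_dx d) (@dist3_dy A) c a b)`_0
  = - map_poly (flow c) (br a b).
Proof.
rewrite /nested_bracket coef_sum.
have inner k : (\sum_(m < size (br c (br a b)`_k))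
    iter k (fun T => - dist3_dy T) (iter m
      (fun T => - (dist3_dx d T + dist3_dy T)) ((br c (br a b)`_k)`_m)%:P%:P))`_0
   = - (flow c (br a b)`_k *: 'X^k).
  have -> : flow c (br a b)`_k = - (dist2_swap d (br c (br a b)`_k))`_0.
    by rewrite /flow (Poisson_anticomm hP) coefN.
  rewrite swap_coef0 // scaleNr opprK coef_sum scaler_suml.
  apply: eq_bigr => m _.
  rewrite (@coef0_iter _ _ (fun D => 'X * D)); last first.
    by move=> T; rewrite /dist3_dy opprK coefCM.
  rewrite (@coef0_iter _ _ (fun D => - map_poly d D)); last first.
    move=> T; rewrite coefN /dist3_dx /dist3_dy !coefD coefN coefXM /= addr0.
    rewrite !coefCM addrK coef_map_id0 //.
    by rewrite /map_poly poly_def size_poly0 big_ord0.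
  rewrite coefC /=; set f := _`_m.
  have -> : iter m (fun D => - map_poly d D) f%:P
            = (iter m (fun f => - d f) f)%:P.
    elim: (nat_of_ord m) => //= j ->; rewrite polyCN; congr (- _).
    by apply/polyP=> i; rewrite coef_map_id0 // !coefC; case: eqP.
  elim: {f m}(k) (iter m _ f) => [|j IH] g /=; first by rewrite expr0 alg_polyC.
  by rewrite IH exprS scalerAr.
under eq_bigr => k _ do rewrite inner.
by rewrite sumrN /map_poly poly_def.
Qed.

(** The Jacobi identity integrated over the point of c: the flow of an integral
preserves the Poisson structure. *)
Lemma flow_bracket a b c :
  map_poly (flow c) (br a b) = br (flow c a) b + br a (flow c b).
Proof.
have /(congr1 (fun T : dist3 A => T`_0)) := Poisson_Jacobi hP a b c.
rewrite !coefD int_nested_bracket_abc int_nested_bracket_bca.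
rewrite int_nested_bracket_cab coef0.
by move/eqP; rewrite subr_eq0 addrC => /eqP.
Qed.

End Poisson.

(** * Brackets with polynomial functions of a field *)

Section PolynomialFunctions.
Variables (C A : fieldType) (iota : {rmorphism C -> A}) (d : A -> A).
Variable br : A -> A -> dist2 A.
Hypotheses (dD : forall f g, d (f + g) = d f + d g)
           (dM : forall f g, d (f * g) = d f * g + f * d g)
           (dC : forall c, d (iota c) = 0).
Hypothesis hP : is_Poisson_structure iota d br.
Let hL := Poisson_local hP.

Definition ev (p : A) (F : {poly C}) : A := (map_poly iota F).[p].

Lemma ev0 p : ev p 0 = 0. Proof. by rewrite /ev rmorph0 horner0. Qed.
Lemma evD p F G : ev p (F + G) = ev p F + ev p G.
Proof. by rewrite /ev rmorphD hornerD. Qed.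
Lemma evN p F : ev p (- F) = - ev p F.
Proof. by rewrite /ev rmorphN hornerN. Qed.
Lemma evM p F G : ev p (F * G) = ev p F * ev p G.
Proof. by rewrite /ev rmorphM hornerM. Qed.
Lemma evC p c : ev p c%:P = iota c.
Proof. by rewrite /ev map_polyC hornerC. Qed.
Lemma evX p : ev p 'X = p.
Proof. by rewrite /ev map_polyX hornerX. Qed.

Lemma der_ev p F : d (ev p F) = ev p F^`() * d p.
Proof.
elim/poly_ind: F => [|F c IH]; first by rewrite deriv0 ev0 mul0r der0.
rewrite derivMXaddC !evD !evM evC evX dD dM dC IH; ring.
Qed.

Lemma br_constl c b : br (iota c) b = 0.
Proof.
have br1 : br 1 b = 0.
  apply: (addrI (br 1 b)); have := brMl hL 1 1 b.
  by rewrite mulr1 /dist2_xmul !mul1r addr0 => <-.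
by rewrite -[iota c]mulr1 (brZl hL) br1 /dist2_xmul mulr0.
Qed.

Lemma br_evl p F b : br (ev p F) b = dist2_xmul (ev p F^`()) (br p b).
Proof.
rewrite /dist2_xmul; elim/poly_ind: F => [|F c IH].
  by rewrite deriv0 ev0 (br0l hP) polyC0 mul0r.
rewrite derivMXaddC !evD !evM evC evX (brDl hL) br_constl (brMl hL) IH.
by rewrite /dist2_xmul polyCD polyCM; ring.
Qed.

Lemma anticomm_coefs a b : (size (br a b) <= 2)%N ->
  (br b a)`_0 = d (br a b)`_1 - (br a b)`_0 /\ (br b a)`_1 = (br a b)`_1.
Proof.
move=> /(coef_swap2 dD)[e0 e1].
by rewrite (Poisson_anticomm hP) !coefN e0 e1 opprB opprK.
Qed.

Lemma br_constr c a : br a (iota c) = 0.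
Proof.
rewrite (Poisson_anticomm hP) br_constl /dist2_swap size_poly0 big_ord0 oppr0 //.
Qed.

Lemma coef_brMr a b b' : (size (br a b) <= 3)%N -> (size (br a b') <= 3)%N ->
  [/\ (br a (b * b'))`_2 = b * (br a b')`_2 + b' * (br a b)`_2,
      (br a (b * b'))`_1 = b * (br a b')`_1 + 2 * d b * (br a b')`_2
                         + (b' * (br a b)`_1 + 2 * d b' * (br a b)`_2)
    & (br a (b * b'))`_0 =
        b * (br a b')`_0 + d b * (br a b')`_1 + d (d b) * (br a b')`_2
      + (b' * (br a b)`_0 + d b' * (br a b)`_1 + d (d b') * (br a b)`_2)].
Proof.
move=> s s'; have [e2 e1 e0] := coef_ymul dD b s'.
have [e2' e1' e0'] := coef_ymul dD b' s.
by rewrite (brMr hL) !coefD e0 e1 e2 e0' e1' e2'.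
Qed.

Lemma size_brMr n a b b' : (size (br a b) <= n)%N -> (size (br a b') <= n)%N ->
  (size (br a (b * b')) <= n)%N.
Proof.
move=> s s'; rewrite (brMr hL) (leq_trans (size_polyD _ _)) // geq_max.
by rewrite !(leq_trans (size_ymul _ _ _)).
Qed.

Lemma size_brdr n a b : (size (br a b) <= n)%N -> (size (br a (d b)) <= n.+1)%N.
Proof.
move=> s; rewrite (brdr hL); apply/leq_sizeP=> -[|j] // nj.
by rewrite coef_dy nth_default ?oppr0 // (leq_trans s).
Qed.

(** The chain rule in the second argument.  The factor F'(p(y)) has to be moved
to the point x, which differentiates it against delta'. *)
Lemma br_evr p F a : (size (br a p) <= 2)%N ->
  [/\ (size (br a (ev p F)) <= 2)%N,
      (br a (ev p F))`_1 = ev p F^`() * (br a p)`_1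
    & (br a (ev p F))`_0 = ev p F^`() * (br a p)`_0 + d (ev p F^`()) * (br a p)`_1].
Proof.
move=> s; have s3 : (size (br a p) <= 3)%N by apply: leq_trans s _.
have s2 : (br a p)`_2 = 0 by rewrite nth_default.
elim/poly_ind: F => [|F c [sF e1 e0]].
  by rewrite deriv0 !ev0 (br0r hP) size_poly0 !coef0 (der0 dD) // !mul0r addr0.
have sF3 : (size (br a (ev p F)) <= 3)%N by apply: leq_trans sF _.
have sF2 : (br a (ev p F))`_2 = 0 by rewrite nth_default.
have E : br a (ev p (F * 'X + c%:P)) = br a (ev p F * p).
  by rewrite evD evM evX evC (brDr hL) br_constr addr0.
have [_ m1 m0] := coef_brMr sF3 s3.
rewrite E derivMXaddC; split; first exact: size_brMr.
  by rewrite m1 e1 s2 sF2 evD evM evX; ring.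
by rewrite m0 e1 e0 s2 sF2 evD evM evX dD dM der_ev; ring.
Qed.

Lemma flowD c a b : flow br c (a + b) = flow br c a + flow br c b.
Proof. by rewrite /flow (brDl hL) coefD. Qed.

Lemma flowM c a b : flow br c (a * b) = a * flow br c b + b * flow br c a.
Proof. by rewrite /flow (brMl hL) coefD !coefCM. Qed.

Lemma flowd c a : flow br c (d a) = d (flow br c a).
Proof. by rewrite /flow (brdl hL) coef_dx // addr0. Qed.

Lemma flow_ev c p F : flow br c (ev p F) = ev p F^`() * flow br c p.
Proof. by rewrite /flow br_evl coefCM. Qed.

Lemma flow0 c : flow br c 0 = 0.
Proof. by rewrite /flow (br0l hP) coef0. Qed.

Lemma flow_bracket_coef a b c n :
  flow br c (br a b)`_n = (br (flow br c a) b)`_n + (br a (flow br c b))`_n.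
Proof.
by rewrite -coefD -(flow_bracket dD hP) coef_map_id0 // flow0.
Qed.

End PolynomialFunctions.

(** * Specialization of differential rational functions *)

Section Specialization.
Variables (C A : fieldType) (iota : {rmorphism C -> A}).
Variables (d : A -> A) (z : 'I_2 -> A).
Hypothesis hA : is_jet_field iota d z.

Let dD := jet_derD hA.
Let dM := jet_derM hA.
Local Notation w := (z ord_max).
Local Notation p := (z ord0 / w).

(** The jets z_1, z_2, z_1', z_2', z_1'', z_2'' in this order. *)
Definition jet_index (i : 'I_6) : 'I_2 * nat :=
  (if odd i then ord_max else ord0, i./2).

(** The values z_1 = X, z_2 = 1, zero first derivatives, z_1'' = X and z_2'' = 1.
They are chosen so that p = X, w = w'' = 1 and p' = p'' = w' = 0: of the terms
of second order in the derivatives only the coefficient of w'' remains. *)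
Definition jet_value (i : 'I_6) : {poly C} := [:: 'X; 1; 0; 0; 'X; 1]`_i.

Lemma jet_index_inj : injective jet_index.
Proof.
move=> i j [Eo Eh]; apply: val_inj => /=.
rewrite -(odd_double_half i) -(odd_double_half j) Eh; congr (_ + _)%N.
by case: (odd i) Eo; case: (odd j).
Qed.

(** Evaluation at the jet [jet_value] is defined only for quotients of
differential polynomials whose denominator does not vanish there; powers of
z_2 suffice as denominators, and they take the value 1. *)
Definition specializes (f : A) (F : {poly C}) : Prop :=
  exists n (P : {mpoly C[6]}),
    f * w ^+ n = jet_eval iota d z jet_index P /\ mmap (@polyC C) jet_value P = F.

Lemma specializes_jet (i : 'I_6) :
  specializes (iter (jet_index i).2 d (z (jet_index i).1)) (jet_value i).
Proof.
by exists 0%N, 'X_i; rewrite expr0 mulr1 /jet_eval !mmapX !mmap1U.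
Qed.

Lemma specializes_C c : specializes (iota c) c%:P.
Proof. by exists 0%N, c%:MP; rewrite expr0 mulr1 /jet_eval !mmapC. Qed.

Lemma specializesM f g F G :
  specializes f F -> specializes g G -> specializes (f * g) (F * G).
Proof.
move=> [n [P [Ef EP]]] [m [Q [Eg EQ]]]; exists (n + m)%N, (P * Q).
rewrite /jet_eval !rmorphM /= EP EQ -[mmap iota _ P]Ef -[mmap iota _ Q]Eg.
by rewrite exprD mulrACA.
Qed.

Lemma specializes_w : specializes w 1.
Proof. exact: (specializes_jet (@Ordinal 6 1 isT)). Qed.

Lemma jet_eval_w : w = jet_eval iota d z jet_index 'X_(@Ordinal 6 1 isT).
Proof. by rewrite /jet_eval mmapX mmap1U. Qed.

Lemma w_neq0 : w != 0.
Proof.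
apply/eqP=> w0; have := jet_eval_w; rewrite w0 => /esym.
move/(jet_free hA jet_index_inj) => /(congr1 (mmap (@polyC C) jet_value)).
by rewrite mmapX mmap1U mmap0 /jet_value /= => /eqP; rewrite oner_eq0.
Qed.

Lemma specializesD f g F G :
  specializes f F -> specializes g G -> specializes (f + g) (F + G).
Proof.
move=> [n [P [Ef EP]]] [m [Q [Eg EQ]]].
pose W : {mpoly C[6]} := 'X_(@Ordinal 6 1 isT).
have EW : mmap (@polyC C) jet_value W = 1 by rewrite mmapX mmap1U.
exists (n + m)%N, (P * W ^+ m + Q * W ^+ n).
split; last by rewrite rmorphD !rmorphM !rmorphXn /= EP EQ EW !expr1n !mulr1.
rewrite /jet_eval rmorphD !rmorphM !rmorphXn /=.
rewrite -[mmap iota _ P]Ef -[mmap iota _ Q]Eg -[mmap iota _ W]jet_eval_w.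
by rewrite exprD; ring.
Qed.

Lemma specializesN f F : specializes f F -> specializes (- f) (- F).
Proof.
move=> sf; rewrite -mulN1r -[- F]mulN1r -(rmorphN1 iota) -(rmorphN1 (@polyC C)).
by apply: specializesM => //; apply: specializes_C.
Qed.

Lemma specializes_div f F : specializes (f * w) F -> specializes f F.
Proof. by move=> [n [P [Ef EP]]]; exists n.+1, P; rewrite exprS mulrA. Qed.

Lemma specializes0 F : specializes 0 F -> F = 0.
Proof.
move=> [n [P [/esym]]]; rewrite mul0r.
by move/(jet_free hA jet_index_inj) => -> <-; rewrite mmap0.
Qed.

(** Evaluation is well defined because the jets are algebraically
independent.  This is what makes equations between elements of A into
equations between polynomials. *)
Lemma specializes_inj f F G : specializes f F -> specializes f G -> F = G.
Proof.
move=> sF /specializesN sG; have := specializesD sF sG; rewrite subrr.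
by move/specializes0/eqP; rewrite subr_eq0 => /eqP.
Qed.

Lemma specializes_nat n : specializes n%:R n%:R.
Proof.
by rewrite -(rmorph_nat iota) -(rmorph_nat (@polyC C)); apply: specializes_C.
Qed.

Lemma specializes_p : specializes p 'X.
Proof.
apply: specializes_div; rewrite divfK ?w_neq0 //.
exact: (specializes_jet (@Ordinal 6 0 isT)).
Qed.

Lemma specializes_poly F : specializes (map_poly iota F).[p] F.
Proof.
elim/poly_ind: F => [|F c IH].
  by rewrite rmorph0 horner0; apply: (specializes_nat 0).
rewrite rmorphD rmorphM /= map_polyX map_polyC hornerD hornerM hornerX hornerC.
apply: specializesD; last exact: specializes_C.
by apply: specializesM IH _; apply: specializes_p.
Qed.

Lemma z0E : z ord0 = p * w. Proof. by rewrite divfK ?w_neq0. Qed.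

Lemma dz0E : d (z ord0) = d p * w + p * d w.
Proof. by rewrite -dM -z0E. Qed.

Lemma specializes_dw : specializes (d w) 0.
Proof. exact: (specializes_jet (@Ordinal 6 3 isT)). Qed.

Lemma specializes_ddw : specializes (d (d w)) 1.
Proof. exact: (specializes_jet (@Ordinal 6 5 isT)). Qed.

Lemma specializes_dp : specializes (d p) 0.
Proof.
apply: specializes_div.
have -> : d p * w = d (z ord0) + - (p * d w) by rewrite dz0E addrK.
rewrite (_ : 0 = 0 + - ('X * 0) :> {poly C}); last by ring.
apply: specializesD; first exact: (specializes_jet (@Ordinal 6 2 isT)).
by apply/specializesN/specializesM; [apply: specializes_p|apply: specializes_dw].
Qed.

Lemma specializes_ddp : specializes (d (d p)) 0.
Proof.
apply: specializes_div.
have -> : d (d p) * w = d (d (z ord0)) + - (2%:R * (d p * d w)) + - (p * d (d w)).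
  by rewrite dz0E dD (dM (d p)) (dM p); ring.
rewrite (_ : 0 = 'X + - (2%:R * (0 * 0)) + - ('X * 1) :> {poly C}); last by ring.
apply: specializesD; first apply: specializesD.
- exact: (specializes_jet (@Ordinal 6 4 isT)).
- apply/specializesN/specializesM; first exact: specializes_nat.
  by apply/specializesM; apply: specializes_dp || apply: specializes_dw.
- by apply/specializesN/specializesM; [apply: specializes_p|apply: specializes_ddw].
Qed.

End Specialization.

(** * The Jacobi identity in the coordinates p and w *)

Section JacobiCoefficients.
Variables (C A : fieldType) (iota : {rmorphism C -> A}) (d : A -> A).
Variables (z : 'I_2 -> A) (hA : is_jet_field iota d z).
Variable br : A -> A -> dist2 A.
Hypothesis hP : is_Poisson_structure iota d br.
Variables (p w : A) (hp : p = z ord0 / z ord_max) (hw : w = z ord_max).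
(* [Gh] is half the derivative of [G]. *)
Variables (B b1 E K G Gh : {poly C}).
Hypothesis spw : (size (br p w) <= 2)%N.
Hypothesis pw1 : (br p w)`_1 = w * ev iota p B.
Hypothesis pw0 : (br p w)`_0 = w * ev iota p b1 * d p + ev iota p E * d w.
Hypothesis sww : (size (br w w) <= 2)%N.
Hypothesis ww1 : (br w w)`_1 = w * w * ev iota p K.
Hypothesis ww0 : 2 * (br w w)`_0 = d (w * w * ev iota p K).
Hypothesis spp : (size (br p p) <= 2)%N.
Hypothesis pp1 : (br p p)`_1 = ev iota p G.
Hypothesis pp0 : (br p p)`_0 = ev iota p Gh * d p.

Let dD := jet_derD hA.
Let dM := jet_derM hA.
Let dC := jet_derC hA.
Local Notation e := (ev iota p).
Local Notation spec := (specializes iota d z).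

Let spec_p : spec p 'X. Proof. rewrite hp; exact: specializes_p. Qed.
Let spec_dp : spec (d p) 0. Proof. rewrite hp; exact: specializes_dp. Qed.
Let spec_ddp : spec (d (d p)) 0. Proof. rewrite hp; exact: specializes_ddp. Qed.
Let spec_w : spec w 1. Proof. rewrite hw; exact: specializes_w. Qed.
Let spec_dw : spec (d w) 0. Proof. rewrite hw; exact: specializes_dw. Qed.
Let spec_ddw : spec (d (d w)) 1. Proof. rewrite hw; exact: specializes_ddw. Qed.
Let spec_ev F : spec (e F) F. Proof. rewrite /ev hp; exact: specializes_poly. Qed.

Let spec_eq f g : f = g -> forall F G, spec f F -> spec g G -> F = G.
Proof. by move=> -> F G0; apply: (specializes_inj hA). Qed.

(* Computes the value of an explicit expression in p, w, their derivatives and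
   polynomials in p as an existential variable. *)
Ltac specialize_jets :=
  lazymatch goal with
  | |- specializes _ _ _ (_ + _) _ => eapply specializesD; specialize_jets
  | |- specializes _ _ _ (- _) _ => eapply specializesN; specialize_jets
  | |- specializes _ _ _ (_ * _) _ => eapply specializesM; specialize_jets
  | |- specializes _ _ _ (d (d p)) _ => exact spec_ddp
  | |- specializes _ _ _ (d (d w)) _ => exact spec_ddw
  | |- specializes _ _ _ (d p) _ => exact spec_dp
  | |- specializes _ _ _ (d w) _ => exact spec_dw
  | |- specializes _ _ _ p _ => exact spec_p
  | |- specializes _ _ _ w _ => exact spec_w
  | |- specializes _ _ _ (ev _ _ _) _ => apply spec_ev
  | |- specializes _ _ _ 0 _ => apply (specializes_nat iota d z 0)
  | |- specializes _ _ _ 1 _ => apply (specializes_nat iota d z 1)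
  | |- specializes _ _ _ (_%:R) _ => apply specializes_nat
  end.

Let der_e F : d (e F) = e F^`() * d p.
Proof. exact: der_ev. Qed.

Lemma flow_p_p : flow br p p = e Gh * d p. Proof. exact: pp0. Qed.

Lemma flow_p_w : flow br p w = w * e (B^`() - b1) * d p + e (B - E) * d w.
Proof.
rewrite /flow; have [-> _] := anticomm_coefs dD hP spw.
by rewrite pw1 pw0 dM der_e !evD !evN; ring.
Qed.

Let coef_brdl a b n :
  (br (d a) b)`_n = d (br a b)`_n + (if n is m.+1 then (br a b)`_m else 0).
Proof. by rewrite (brdl (Poisson_local hP)) coef_dx. Qed.

Let coef_brdr a b n : (br a (d b))`_n = - (if n is m.+1 then (br a b)`_m else 0).
Proof. by rewrite (brdr (Poisson_local hP)) coef_dy. Qed.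

Let coef_brMl a a' b n : (br (a * a') b)`_n = a * (br a' b)`_n + a' * (br a b)`_n.
Proof. by rewrite (brMl (Poisson_local hP)) coefD !coefCM. Qed.

Let coef_brDl a a' b n : (br (a + a') b)`_n = (br a b)`_n + (br a' b)`_n.
Proof. by rewrite (brDl (Poisson_local hP)) coefD. Qed.

Let coef_brDr a b b' n : (br a (b + b'))`_n = (br a b)`_n + (br a b')`_n.
Proof. by rewrite (brDr (Poisson_local hP)) coefD. Qed.

Let coef_br_evl F b n : (br (e F) b)`_n = e F^`() * (br p b)`_n.
Proof. by rewrite (br_evl hP) coefCM. Qed.

Lemma size_br_p_ev F : (size (br p (e F)) <= 2)%N.
Proof. by have [] := br_evr dD dM dC hP F spp. Qed.

Let pw2 : (br p w)`_2 = 0. Proof. by rewrite nth_default. Qed.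
Let ww2 : (br w w)`_2 = 0. Proof. by rewrite nth_default. Qed.
Let pe2 F : (br p (e F))`_2 = 0. Proof. by rewrite nth_default ?size_br_p_ev. Qed.
Let pe1 F : (br p (e F))`_1 = e F^`() * e G.
Proof. by have [_ -> _] := br_evr dD dM dC hP F spp; rewrite pp1. Qed.
Let pe0 F : (br p (e F))`_0 = e F^`() * (e Gh * d p) + d (e F^`()) * e G.
Proof. by have [_ _ ->] := br_evr dD dM dC hP F spp; rewrite pp1 pp0. Qed.

Lemma size_br_p_wev F : (size (br p (w * e F)) <= 2)%N.
Proof. by apply: (size_brMr dD hP) => //; apply: size_br_p_ev. Qed.

Let size3 x : (size (br p x) <= 2)%N -> (size (br p x) <= 3)%N.
Proof. by move=> s; apply: leq_trans s _. Qed.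

(** The coefficient of delta'' in the flow of the integral of p applied to
{p, w}.  For a metric tensor it expresses the vanishing of torsion. *)
Lemma Jacobi_pwp_coef2 : (B^`() - b1) * G = (Gh + E - B) * B.
Proof.
have := flow_bracket_coef dD hP p w p 2.
rewrite pw2 (flow0 hP) flow_p_p flow_p_w.
rewrite coef_brMl coef_br_evl coef_brdl /= pw2 (der0 dD) pw1.
have [M2 _ _] := coef_brMr dD hP
  (size3 (size_br_p_wev (B^`() - b1))) (size_brdr hP spp).
have [N2 _ _] := coef_brMr dD hP (size3 (size_br_p_ev (B - E))) (size_brdr hP spw).
rewrite coef_brDr M2 N2 !coef_brdr pp1 pw1 pe2.
rewrite (nth_default 0 (size_br_p_wev _)).
move=> eqA; eassert (H : _ = _); first by apply: (spec_eq eqA); specialize_jets.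
by apply: (eq_mod_eq H); ring.
Qed.

(** The component of the same condition that involves the integral of w. *)
Lemma Jacobi_pww_coef2 : 2 * (b1 * B + (E - B) * K) = K^`() * G.
Proof.
have := flow_bracket_coef dD hP p w w 2.
rewrite pw2 (flow0 hP) => /(congr1 ( *%R 2)).
(* Only twice the coefficient of delta in {w, w} is a total derivative. *)
have -> : 2 * ((br (flow br w p) w)`_2 + (br p (flow br w w))`_2) =
    2 * (br (flow br w p) w)`_2 + (br p (2 * flow br w w))`_2.
  by rewrite [2 * flow _ _ _]mulr_natl mulr2n coef_brDr; ring.
have [_ W1 _] := coef_brMr dD hP (size3 spw) (size3 spw).
have sww2 : (size (br p (w * w)) <= 2)%N by apply: size_brMr dD hP _ _ _ _ _ _.
have [_ M1 _] := coef_brMr dD hP (size3 sww2) (size3 (size_br_p_ev K)).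
rewrite /flow ww0 coef_brdr M1 W1 (nth_default 0 sww2) pe1 pe2 pw0 pw1 pw2.
rewrite coef_brDl !coef_brMl !coef_br_evl !coef_brdl /= pw2 ww2 (der0 dD) pw1 ww1.
rewrite !(der_e, dM).
move=> eqA; eassert (H : _ = _); first by apply: (spec_eq eqA); specialize_jets.
by apply: (eq_mod_eq (esym H)); ring.
Qed.

(** The coefficient of w'' delta in the flow of the integral of p applied to
{p, w}: a component of the curvature. *)
Lemma Jacobi_pwp_coef0 : (B^`() - b1) * G + (E - B)^`() * G = E * (Gh + E - B).
Proof.
have := flow_bracket_coef dD hP p w p 0.
rewrite pw0 (flowD hP) !(flowM hP).
rewrite !(flowd dD hP) !(flow_ev hP) flow_p_p flow_p_w.
rewrite coef_brMl coef_br_evl coef_brdl /= pw0.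
have [_ _ M0] := coef_brMr dD hP
  (size3 (size_br_p_wev (B^`() - b1))) (size_brdr hP spp).
have [_ _ N0] := coef_brMr dD hP (size3 (size_br_p_ev (B - E))) (size_brdr hP spw).
have [_ V1 V0] := coef_brMr dD hP (size3 spw) (size3 (size_br_p_ev (B^`() - b1))).
rewrite coef_brDr M0 N0 V0 V1 !coef_brdr !pe2 !pe1 !pe0 pp0 pp1 pw0 pw1 pw2.
rewrite (nth_default 0 (size_br_p_wev _)) !mulr0 !addr0.
rewrite ?(der_e, dD, dM).
move=> eqA; eassert (H : _ = _); first by apply: (spec_eq eqA); specialize_jets.
by apply: (eq_mod_eq H); ring.
Qed.

End JacobiCoefficients.

(** * Polynomials with simple roots *)

Section Polynomials.
Variable C : numClosedFieldType.
Implicit Types G b : {poly C}.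

Definition simple_roots G := forall a, root G a -> ~~ root G^`() a.

Lemma simple_roots_dvdp G b :
  G != 0 -> simple_roots G -> (forall a, root G a -> root b a) -> G %| b.
Proof.
move=> G0 Gs Gb; have [rs Ers] := closed_field_poly_normal G.
have lG0 : lead_coef G != 0 by rewrite lead_coef_eq0.
have rsG a : (a \in rs) = root G a.
  by rewrite Ers rootZ // root_prod_XsubC.
have P0 : \prod_(a <- rs) ('X - a%:P) != 0 by rewrite monic_neq0 ?monic_prod_XsubC.
have Urs : uniq rs.
  apply: count_mem_uniq => a; rewrite -has_pred1 has_count.
  suff : (count_mem a rs <= 1)%N by case: (count_mem a rs) => [|[]].
  rewrite -mu_prod_XsubC mup_leq //; apply/negP => /dvdpP [h EP].
  have aG : root G a.
    by rewrite Ers rootZ // EP rootM root_exp_XsubC eqxx orbT.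
  apply: (negP (Gs a aG)).
  rewrite Ers EP derivZ rootZ // derivM deriv_exp rootE !hornerE subrr /=.
  by rewrite !(mul0r, mulr0, addr0).
rewrite Ers dvdpZl // uniq_roots_dvdp //.
  by apply/allP=> a; rewrite rsG; apply: Gb.
by rewrite uniq_rootsE.
Qed.

(** Three of the four roots are finite if infinity is one of them, and its
multiplicity then bounds the degree by 3; in either case the number of finite
roots is the degree. *)
Lemma four_distinct_simple_roots G : (size G <= 5)%N ->
  four_distinct_P1_roots G -> (3 < size G)%N /\ simple_roots G.
Proof.
move=> sG [G0 [s [Us ss /allP Gs]]].
pose rs := pmap id s.
have Urs : uniq rs by apply: pmap_uniq Us => // -[].
have rsG : all (root G) rs.
  apply/allP=> a; rewrite mem_pmap map_id => /Gs /=.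
  by rewrite -XsubC_dvd // root_factor_theorem.
have sinf : (None \in s -> size G <= 4)%N.
  by move/Gs => /=; case: (size G) => [|[|[|[|[|n]]]]].
have srs : (size rs + (None \in s) = 4)%N.
  rewrite -ss -(count_predC isSome s) size_pmap -count_uniq_mem //; congr (_ + _)%N.
  by apply: eq_count => -[].
have lt := max_poly_roots G0 rsG Urs.
have Es : size G = (size rs).+1.
  apply/eqP; rewrite eqn_leq lt andbT; move: sinf srs.
  case: (None \in s) => /= [/(_ isT) ? | _].
    by rewrite addn1 => -[->].
  by rewrite addn0 => ->.
split.
  move: srs; rewrite Es; case: (None \in s); first by rewrite addn1 => -[->].
  by rewrite addn0 => ->.
have EG : G = lead_coef G *: \prod_(a <- rs) ('X - a%:P).
  by apply: all_roots_prod_XsubC; rewrite ?uniq_rootsE.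
move=> a aG; apply/negP => aG'.
have ars : a \in rs.
  by move: aG; rewrite EG rootZ ?lead_coef_eq0 // root_prod_XsubC.
have : G = ('X - a%:P) * (lead_coef G *: \prod_(x <- rem a rs) ('X - x%:P)).
  by rewrite {1}EG (big_rem a) //= scalerAr.
set h := _ *: _ => Eh.
have : root h a.
  move: aG'; rewrite Eh derivM derivXsubC mul1r !rootE !hornerE subrr.
  by rewrite mul0r addr0.
by rewrite /h rootZ ?lead_coef_eq0 // root_prod_XsubC mem_rem_uniqF.
Qed.

Lemma coef_deriv_lead_neq0 G : (1 < size G)%N ->
  (G^`())`_(size G).-2 != 0.
Proof.
case Es : (size G) => [|[|n]] //= _.
rewrite coef_deriv Num.Theory.mulrn_eq0 /=.
have := lead_coef_eq0 G; rewrite lead_coefE Es /= => ->.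
by rewrite -size_poly_eq0 Es.
Qed.

(** Let a be a root of b, of multiplicity k > 0.  The term b^2 vanishes at a to
order 2 k.  If G(a) != 0, then G b' has order k - 1 only and G' b has order at
least k.  If G(a) = 0, this root is simple, and the terms of order k on the two
sides are 2 k and 1 times the same nonzero number.  Neither is possible, so b
is a constant c, and c != 0 would give G' = - 2 c, but G' is not constant. *)
Lemma riccati_poly_eq0 G b : (2 < size G)%N -> simple_roots G ->
  2 * (G * b^`()) = G^`() * b + 2 * b ^+ 2 -> b = 0.
Proof.
move=> sG Gs eq_b; apply/eqP/negPn/negP => b0.
have two0 : (2 : C) != 0 by rewrite Num.Theory.pnatr_eq0.
have [sb1|sbN1] := eqVneq (size b) 1%N.
  have [c c0 Eb] := size_poly1P _ (introT eqP sb1).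
  have /eqP := eq_b; rewrite Eb derivC !mulr0 eq_sym expr2 mulrA -mulrDl.
  rewrite mulf_eq0 polyC_eq0 (negPf c0) orbF => /eqP.
  move/(congr1 (fun p : {poly C} => p`_(size G).-2)).
  have := coef_deriv_lead_neq0 (ltnW sG).
  case: (size G) sG => [|[|[|n]]] //= _ /negPf lG /eqP.
  rewrite coefD -[2]polyC_natr -polyCM coefC coef0 addr0.
  by rewrite lG.
have [a ra] : exists a, root b a by apply/closed_rootP.
have [m [q]] := multiplicity_XsubC b a; rewrite b0 /= => qa.
case: m => [|m] Eb; first by rewrite Eb expr0 mulr1 (negPf qa) in ra.
set u := 'X - a%:P in Eb.
have Eu : u = 'X - a%:P by []; clearbody u.
have un0 : u != 0 by rewrite Eu polyXsubC_eq0.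
have u0 : u ^+ m != 0 by rewrite expf_neq0.
have ua : u.[a] = 0 by rewrite Eu !hornerE subrr.
have du : u^`() = 1 by rewrite Eu derivXsubC.
(* The equation divided by u ^+ m, then also by the factor u of G. *)
have eq1 : 2 * (G * (q^`() * u + q *+ m.+1)) =
           G^`() * q * u + 2 * (q ^+ 2 * u ^+ m.+1 * u).
  apply: (mulfI u0); apply: (eq_mod_eq eq_b).
  rewrite Eb derivM deriv_exp du mul1r /= (exprS u).
  rewrite -[q *+ _]mulr_natr -[u ^+ m *+ _]mulr_natr.
  by move: (u ^+ m) (m.+1%:R : {poly C}) => v k; ring.
have two_a : (2 : {poly C}).[a] = 2 by rewrite -polyC_natr hornerC.
have Ga : root G a.
  have := congr1 (fun p => p.[a]) eq1.
  rewrite !(two_a, ua, hornerM, hornerD, hornerMn) !(mulr0, addr0, add0r) => /eqP.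
  rewrite !mulf_eq0 (negPf two0) /= Num.Theory.mulrn_eq0 /=.
  by rewrite -[q.[a] == 0]/(root q a) (negPf qa) orbF.
have /factor_theorem [H EG] := Ga.
rewrite -Eu in EG.
have eq2 : 2 * (H * (q^`() * u + q *+ m.+1)) =
           (H^`() * u + H) * q + 2 * (q ^+ 2 * u ^+ m.+1).
  apply: (mulfI un0); apply: (eq_mod_eq eq1).
  rewrite EG derivM du mulr1 -[q *+ _]mulr_natr.
  by move: (u ^+ m.+1) (m.+1%:R : {poly C}) => v k; ring.
have := congr1 (fun p => p.[a]) eq2.
have := Gs a Ga.
rewrite EG derivM du mulr1 rootE hornerD hornerM ua mulr0 add0r => Ha.
rewrite (exprS u) !(two_a, ua, hornerM, hornerD, hornerMn).
rewrite !(mul0r, mulr0, addr0, add0r) => eq_a.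
have : ((2 * m.+1)%:R - 1) * (H.[a] * q.[a]) = 0.
  by apply: (eq_mod_eq eq_a); rewrite natrM -[q.[a] *+ _]mulr_natr; ring.
move/eqP; rewrite !mulf_eq0 (negPf Ha) -[q.[a] == 0]/(root q a) (negPf qa).
by rewrite !orbF subr_eq0 -[1]/(1%:R) Num.Theory.eqr_nat; lia.
Qed.

(** The case beta = 0, in which the Killing field d/du has constant length.
The hypothesis on Q00 is the degree bound that comes from z_1. *)
Lemma constant_norm_absurd (Q00 Q01 Q11 b1 G : {poly C}) :
  (size Q00 <= 3)%N -> (size Q01 <= 3)%N -> (size Q11 <= 3)%N ->
  (3 < size G)%N -> simple_roots G ->
  let B := Q01 - 'X * Q11 in
  Q00 = 'X ^+ 2 * Q11 + 2 * ('X * B) + G ->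
  2 * ((B^`() - b1) * G) = G^`() * B ->
  2 * (b1 * B) = G * Q11^`() -> False.
Proof.
move=> s00 s01 s11 sG Gs B EQ T1 T2.
have G0 : G != 0 by rewrite -size_poly_eq0; lia.
have sB : (size B <= 4)%N.
  rewrite (leq_trans (size_polyD _ _)) // geq_max (leq_trans s01) //=.
  by rewrite size_polyN (leq_trans (size_polyMleq _ _)) // size_polyX /= ltnS.
have /dvdpP [h EB] : G %| B.
  apply: simple_roots_dvdp => // a Ga.
  have : root (G^`() * B) a by rewrite -T1 !rootM Ga !orbT.
  by rewrite rootM (negPf (Gs a Ga)).
have [c Eh] : exists c, h = c%:P.
  exists h`_0; apply: size1_polyC.
  have [->|h0] := eqVneq h 0; first by rewrite size_poly0.
  move: sB; rewrite EB size_mul //; move: (size G) sG (size h) => n sn k; lia.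
have Eb1 : 2 * b1 = c%:P * G^`().
  apply: (mulIf G0); apply: (eq_mod_eq (esym T1)).
  by rewrite EB Eh derivM derivC mul0r add0r; ring.
have EQ11 : Q11^`() = (c ^+ 2)%:P * G^`().
  apply: (mulfI G0); rewrite -T2 EB Eh mulrA Eb1 expr2 polyCM; ring.
(* Q11 is at most quadratic, whereas G^`() has degree at least 2. *)
have c0 : c = 0.
  have := coef_deriv_lead_neq0 (ltn_trans (isT : 1 < 3)%N sG) => lG.
  have := congr1 (fun p : {poly C} => p`_(size G).-2) EQ11.
  rewrite coefCM coef_deriv nth_default ?mul0rn; last first.
    by apply: leq_trans s11 _; case: (size G) sG => [|[|[|n]]].
  move/esym/eqP; rewrite mulf_eq0 (negPf lG) orbF expf_eq0 /= => /eqP->//.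
have Q11c : (size Q11 <= 1)%N.
  apply/leq_sizeP => -[|j] // _; have := congr1 (fun p : {poly C} => p`_j) EQ11.
  rewrite c0 expr0n /= mul0r coef0 coef_deriv => /eqP.
  by rewrite Num.Theory.mulrn_eq0 => /eqP.
have : (size G <= 3)%N.
  have -> : G = Q00 - 'X ^+ 2 * Q11.
    by rewrite EQ EB Eh c0; ring.
  rewrite (leq_trans (size_polyD _ _)) // geq_max s00 size_polyN.
  by rewrite (leq_trans (size_polyMleq _ _)) // size_polyXn /=.
by rewrite leqNgt sG.
Qed.

End Polynomials.

(** * Brackets quadratic in the fields *)

(** The quadratic form with coefficients c at (z_1, z_2) is z_2^2 times the
value of [quad_poly c] at z_1 / z_2. *)
Definition quad_poly (C : fieldType) (c : 'I_2 -> 'I_2 -> C) : {poly C} :=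
  c ord0 ord0 *: 'X^2 + (c ord0 ord_max + c ord_max ord0) *: 'X
  + (c ord_max ord_max)%:P.

(** In the sum of the c_ij z_i z_j' only j = 1 produces p', since z_1 = p w and
z_2 = w; [lin_poly c] is the factor of w^2 p'. *)
Definition lin_poly (C : fieldType) (c : 'I_2 -> 'I_2 -> C) : {poly C} :=
  c ord0 ord0 *: 'X + (c ord_max ord0)%:P.

Lemma size_quad_poly (C : fieldType) (c : 'I_2 -> 'I_2 -> C) :
  (size (quad_poly c) <= 3)%N.
Proof.
apply/leq_sizeP => j j3; rewrite /quad_poly !coefD !coefZ coefXn coefX coefC.
by case: j j3 => [|[|[|j]]] //= _; rewrite !mulr0 !addr0.
Qed.

Lemma sum2E (V : nmodType) (F : 'I_2 -> V) : \sum_(i < 2) F i = F ord0 + F ord_max.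
Proof. by rewrite big_ord_recl big_ord1; congr (_ + F _); apply: val_inj. Qed.

Section QuadraticBracket.
Variables (C : numClosedFieldType) (A : fieldType) (iota : {rmorphism C -> A}).
Variables (d : A -> A) (z : 'I_2 -> A) (hA : is_jet_field iota d z).
Variable br : A -> A -> dist2 A.
Hypothesis hP : is_Poisson_structure iota d br.
Variables (q r : 'I_2 -> 'I_2 -> 'I_2 -> 'I_2 -> C).
Hypothesis hz : forall a b : 'I_2, br (z a) (z b) =
            hydro_dist
              (\sum_(c < 2) \sum_(e < 2) iota (q a b c e) * z c * z e)
              (\sum_(c < 2) \sum_(e < 2) iota (r a b c e) * z c * d (z e)).
Variables (G : {poly C}) (p w : A).
Hypotheses (hp : p = z ord0 / z ord_max) (hw : w = z ord_max).
Hypothesis hG : br p p = hydro_dist (map_poly iota G).[p]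
              (2^-1 * (map_poly iota G^`()).[p] * d p).
Let dD := jet_derD hA.
Let dM := jet_derM hA.
Let dC := jet_derC hA.
Local Notation e := (ev iota p).

Let w0 : w != 0. Proof. by rewrite hw (w_neq0 hA). Qed.
Let zE : z ord0 = p * w. Proof. by rewrite hp hw divfK // -hw. Qed.

Lemma evZ c F : e (c *: F) = iota c * e F.
Proof. by rewrite -mul_polyC evM evC. Qed.

Lemma quad_sumE (c : 'I_2 -> 'I_2 -> C) :
  \sum_(i < 2) \sum_(j < 2) iota (c i j) * z i * z j = w * w * e (quad_poly c).
Proof.
rewrite !sum2E zE -hw /quad_poly !evD !evZ evC expr2 evM evX rmorphD; ring.
Qed.

Lemma quad_dsumE (c : 'I_2 -> 'I_2 -> C) :
  \sum_(i < 2) \sum_(j < 2) iota (c i j) * z i * d (z j)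
  = w * w * e (lin_poly c) * d p + w * e (quad_poly c) * d w.
Proof.
rewrite !sum2E zE -hw /quad_poly /lin_poly !evD !evZ !evC expr2 evM evX.
by rewrite rmorphD dM; ring.
Qed.

Lemma coef_hydro_dist (f g : A) n :
  (hydro_dist f g)`_n = match n with 0 => g | 1 => f | _ => 0 end.
Proof.
rewrite /hydro_dist coefD coefCM coefX coefC.
by case: n => [|[|n]] /=; rewrite ?mulr0 ?mulr1 ?add0r ?addr0.
Qed.

Lemma size_hydro_dist (f g : A) : (size (hydro_dist f g) <= 2)%N.
Proof. by apply/leq_sizeP => -[|[|j]] // _; rewrite coef_hydro_dist. Qed.

Let Q a b := quad_poly (q a b).
Let o := ord0 : 'I_2.
Let m := ord_max : 'I_2.
Let B := Q o m - 'X * Q m m.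
Let b1 := lin_poly (r o m) - 'X * lin_poly (r m m).
Let E := quad_poly (r o m) - 'X * quad_poly (r m m).

Lemma coef_br_pw n : (br p w)`_n =
  match n with 0 => w * e b1 * d p + e E * d w | 1 => w * e B | _ => 0 end.
Proof.
apply: (mulfI w0).
have := congr1 (fun D : dist2 A => D`_n) (brMl (Poisson_local hP) p w w).
rewrite /= -zE coefD !coefCM {1 2 3}hw !hz !coef_hydro_dist !quad_sumE !quad_dsumE.
move=> eqn; apply: (eq_mod_eq (esym eqn)); rewrite /B /b1 /E /Q.
by case: n {eqn} => [|[|n]]; rewrite ?(evD, evN, evM, evX); ring.
Qed.

Lemma size_br_pw : (size (br p w) <= 2)%N.
Proof. by apply/leq_sizeP => -[|[|j]] // _; rewrite coef_br_pw. Qed.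

Lemma size_br_ww : (size (br w w) <= 2)%N.
Proof. by rewrite hw hz size_hydro_dist. Qed.

Lemma br_ww1 : (br w w)`_1 = w * w * e (Q m m).
Proof. by rewrite {1 2}hw hz coef_hydro_dist quad_sumE. Qed.

Lemma br_ww0 : 2 * (br w w)`_0 = d (w * w * e (Q m m)).
Proof.
have [E0 _] := anticomm_coefs dD hP size_br_ww.
by rewrite mulr_natl mulr2n {1}E0 subrK br_ww1.
Qed.

Let Gh := (2^-1)%:P * G^`().

Lemma br_pp1 : (br p p)`_1 = e G.
Proof. by rewrite hG coef_hydro_dist. Qed.

Lemma br_pp0 : (br p p)`_0 = e Gh * d p.
Proof. by rewrite hG coef_hydro_dist /Gh evM evC fmorphV rmorph_nat. Qed.

Lemma size_br_pp : (size (br p p) <= 2)%N.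
Proof. by rewrite hG size_hydro_dist. Qed.

(** The coefficient of delta' in {z_1, z_1}, computed from z_1 = p w. *)
Lemma metric_coefficient_z0 : Q o o = 'X ^+ 2 * Q m m + 2 * ('X * B) + G.
Proof.
have := congr1 (fun D : dist2 A => D`_1) (brMl (Poisson_local hP) p w (p * w)).
rewrite -{1 2}zE hz coef_hydro_dist quad_sumE coefD !coefCM.
have s3 x y : (size (br x y) <= 2)%N -> (size (br x y) <= 3)%N.
  by move=> s; apply: leq_trans s _.
have -> : (br w (p * w))`_1 = w * w * e (Q o m).
  have soz : (size (br (z o) (z m)) <= 2)%N by rewrite hz size_hydro_dist.
  have [_ E1] := anticomm_coefs dD hP soz.
  by rewrite -zE {1}hw E1 hz coef_hydro_dist quad_sumE.
have [_ -> _] := coef_brMr dD hP (s3 _ _ size_br_pp) (s3 _ _ size_br_pw).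
rewrite (nth_default 0 size_br_pp) !coef_br_pw br_pp1.
have -> : e (Q o m) = e B + p * e (Q m m) by rewrite /B evD evN evM evX subrK.
rewrite -/(Q o o); move: (Q o o) (Q m m) B => Q0 Q1 B' eqA.
have : w * w * e Q0 = w * w * e ('X ^+ 2 * Q1 + 2 * ('X * B') + G).
  by rewrite eqA expr2 [2 * ('X * _)]mulr_natl mulr2n !(evD, evM, evX); ring.
move/(mulfI (mulf_neq0 w0 w0)); rewrite /ev hp => eqp.
apply: (specializes_inj hA); first exact: (specializes_poly hA Q0).
by rewrite eqp; apply: specializes_poly.
Qed.

Lemma quadratic_bracket_absurd : (3 < size G)%N -> simple_roots G -> False.
Proof.
move=> sG Gs.
have T1 := Jacobi_pwp_coef2 hA hP hp hw size_br_pw (coef_br_pw 1) (coef_br_pw 0)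
  size_br_pp br_pp1 br_pp0.
have T2 := Jacobi_pww_coef2 hA hP hp hw size_br_pw (coef_br_pw 1) (coef_br_pw 0)
  size_br_ww br_ww1 br_ww0 size_br_pp br_pp1.
have R := Jacobi_pwp_coef0 hA hP hp hw size_br_pw (coef_br_pw 1) (coef_br_pw 0)
  size_br_pp br_pp1 br_pp0.
have GhE : 2 * Gh = G^`().
  by rewrite /Gh mulrA -[2]polyC_natr -polyCM divff ?mul1r // Num.Theory.pnatr_eq0.
have b20 : E - B = 0.
  apply: (riccati_poly_eq0 (ltnW sG) Gs); rewrite -GhE.
  (* The first equation eliminates b1 from the third. *)
  have R2 : G * (E - B)^`() = (Gh + (E - B)) * (E - B).
    by apply: (eq_mod_eq R); rewrite T1; ring.
  by rewrite R2; ring.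
move: T1 T2; have -> : Gh + E - B = Gh by rewrite -addrA b20 addr0.
rewrite b20 mul0r addr0 => T1 T2.
apply: (constant_norm_absurd (size_quad_poly _) (size_quad_poly _)
  (size_quad_poly _) sG Gs metric_coefficient_z0).
  by rewrite -GhE -mulrA -T1.
by rewrite T2 mulrC.
Qed.

End QuadraticBracket.

Theorem proposition1 (R : realType)
    (A : fieldType) (iota : {rmorphism R[i] -> A}) (d : A -> A)
    (z : 'I_2 -> A) (hA : is_jet_field iota d z)
    (G : {poly R[i]}) (hdeg : (size G <= 5)%N)
    (hG : four_distinct_P1_roots G) :
  ~ exists (q r : 'I_2 -> 'I_2 -> 'I_2 -> 'I_2 -> R[i])
           (br : A -> A -> dist2 A),
      let p := z ord0 / z ord_max in
      [/\ is_Poisson_structure iota d br,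
          forall a b : 'I_2, br (z a) (z b) =
            hydro_dist
              (\sum_(c < 2) \sum_(e < 2) iota (q a b c e) * z c * z e)
              (\sum_(c < 2) \sum_(e < 2) iota (r a b c e) * z c * d (z e))
        & br p p =
            hydro_dist
              (map_poly iota G).[p]
              (2^-1 * (map_poly iota G^`()).[p] * d p)].
Proof.
move=> [q [r [br /= [hP hz hp]]]].
have [sG Gs] := four_distinct_simple_roots hdeg hG.
exact: (quadratic_bracket_absurd hA hP hz erefl erefl hp sG Gs).
Qed.
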